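(* Let $A$ be any unital associative algebra in any symmetric tensor category $\mathcal{C}$ over a field of characteristic zero. Then for all integers $j,k\ge 1$ with $j$ odd, $$[M_j,L_k]\subset L_{k+j}.$$
   Context: A symmetric tensor category is a $k$-linear abelian symmetric monoidal category with exact bilinear tensor product, over a field of characteristic zero (e.g. vector spaces or super vector spaces). With symmetry $\sigma$ and multiplication $m$ of $A$, the commutator is $[\cdot,\cdot]=m\circ(\mathrm{id}-\sigma_{A,A})$; for subobjects $X,Y\subset A$, $[X,Y]$ is the image of $X\otimes Y$ under the commutator (in vector spaces, the span of all $[x,y]=xy-yx$). The lower central series is $L_1=A$, $L_{i+1}=[A,L_i]$ for $i\ge1$, and $M_i:=AL_i$ is the two-sided associative ideal of $A$ generated by $L_i$. *)

(* Defs.v *)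
From mathcomp Require Import all_boot all_order all_algebra.

Set Implicit Arguments.
Unset Strict Implicit.
Unset Printing Implicit Defensive.

Import GRing.Theory.
Local Open Scope ring_scope.

Declare Scope tcat_scope.
Delimit Scope tcat_scope with T.
Local Open Scope tcat_scope.

Reserved Notation "g \oc f" (at level 40, left associativity).
Reserved Notation "X \ox Y" (at level 39, left associativity).
Reserved Notation "f \oxm g" (at level 39, left associativity).

Record linearCat (k : fieldType) : Type := LinearCat {
  obj :> Type;
  hom : obj -> obj -> lmodType k;
  idm : forall X, hom X X;
  comp : forall {X Y Z}, hom Y Z -> hom X Y -> hom X Z
    where "g \oc f" := (comp g f);
  comp_idl : forall X Y (f : hom X Y), idm Y \oc f = f;
  comp_idr : forall X Y (f : hom X Y), f \oc idm X = f;
  compA : forall X Y Z W (h : hom Z W) (g : hom Y Z) (f : hom X Y),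
    h \oc (g \oc f) = (h \oc g) \oc f;
  comp_linearl : forall X Y Z (f : hom X Y),
    linear (fun g : hom Y Z => g \oc f);
  comp_linearr : forall X Y Z (g : hom Y Z),
    linear (fun f : hom X Y => g \oc f)
}.

Arguments hom {k l} X Y.
Arguments idm {k l} X.
Arguments comp {k l X Y Z} g f.
Notation "g \oc f" := (comp g f) : tcat_scope.

Section LinearCategoryTheory.
Variables (k : fieldType) (C : linearCat k).
Implicit Types X Y Z T : C.

Definition mono X Y (i : hom X Y) : Prop :=
  forall T (u v : hom T X), i \oc u = i \oc v -> u = v.

Definition epi X Y (p : hom X Y) : Prop :=
  forall T (u v : hom Y T), u \oc p = v \oc p -> u = v.

Definition is_zero_obj Z : Prop :=
  (forall X (f : hom X Z), f = 0) /\ (forall X (f : hom Z X), f = 0).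

Definition is_biproduct X Y P (iX : hom X P) (iY : hom Y P)
    (pX : hom P X) (pY : hom P Y) : Prop :=
  [/\ pX \oc iX = idm X, pY \oc iY = idm Y, pX \oc iY = 0, pY \oc iX = 0
    & iX \oc pX + iY \oc pY = idm P].

Definition is_kernel K X Y (i : hom K X) (f : hom X Y) : Prop :=
  f \oc i = 0 /\
  forall T (t : hom T X), f \oc t = 0 -> exists! h : hom T K, i \oc h = t.

Definition is_cokernel X Y Q (p : hom Y Q) (f : hom X Y) : Prop :=
  p \oc f = 0 /\
  forall T (t : hom Y T), t \oc f = 0 -> exists! h : hom Q T, h \oc p = t.

(* 0 -> X -> Y -> Z -> 0 *)
Definition short_exact X Y Z (i : hom X Y) (p : hom Y Z) : Prop :=
  is_kernel i p /\ is_cokernel p i.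

Lemma kernel_mono K X Y (i : hom K X) (f : hom X Y) :
  is_kernel i f -> mono i.
Proof.
move=> [fi0 univ] T u v iuv.
have /univ[h [_ hP]] : f \oc (i \oc u) = 0.
  rewrite compA fi0.
  by have /(_ (-1) 0 0) := comp_linearl (Z := Y) u; rewrite scaler0 addr0 scaleN1r addNr.
by rewrite -(hP u erefl) (hP v).
Qed.

End LinearCategoryTheory.

(* Kernels and cokernels are chosen, so that images are functions of the
   morphism; any two choices give isomorphic subobjects. *)
Record abelianCat (k : fieldType) : Type := AbelianCat {
  ab_cat :> linearCat k;
  zero_obj_ex : exists Z : ab_cat, is_zero_obj Z;
  biproduct_ex : forall X Y : ab_cat, exists (P : ab_cat)
    (iX : hom X P) (iY : hom Y P) (pX : hom P X) (pY : hom P Y),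
    is_biproduct iX iY pX pY;
  kerO : forall {X Y : ab_cat}, hom X Y -> ab_cat;
  ker : forall {X Y : ab_cat} (f : hom X Y), hom (kerO f) X;
  kerP : forall (X Y : ab_cat) (f : hom X Y), is_kernel (ker f) f;
  cokerO : forall {X Y : ab_cat}, hom X Y -> ab_cat;
  coker : forall {X Y : ab_cat} (f : hom X Y), hom Y (cokerO f);
  cokerP : forall (X Y : ab_cat) (f : hom X Y), is_cokernel (coker f) f;
  mono_normal : forall (X Y : ab_cat) (i : hom X Y), mono i ->
    exists (Z : ab_cat) (f : hom Y Z), is_kernel i f;
  epi_normal : forall (X Y : ab_cat) (p : hom X Y), epi p ->
    exists (Z : ab_cat) (f : hom Z X), is_cokernel p f
}.

Arguments kerO {k a X Y} f.
Arguments ker {k a X Y} f.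
Arguments cokerO {k a X Y} f.
Arguments coker {k a X Y} f.

Record symTensorCat (k : fieldType) : Type := SymTensorCat {
  st_cat :> abelianCat k;

  tens : st_cat -> st_cat -> st_cat
    where "X \ox Y" := (tens X Y);
  tensm : forall {X X' Y Y' : st_cat},
    hom X X' -> hom Y Y' -> hom (X \ox Y) (X' \ox Y')
    where "f \oxm g" := (tensm f g);
  tensm_id : forall X Y : st_cat, idm X \oxm idm Y = idm (X \ox Y);
  tensm_comp : forall (X X' X'' Y Y' Y'' : st_cat)
    (f' : hom X' X'') (f : hom X X') (g' : hom Y' Y'') (g : hom Y Y'),
    (f' \oc f) \oxm (g' \oc g) = (f' \oxm g') \oc (f \oxm g);
  tensm_linearl : forall (X X' Y Y' : st_cat) (g : hom Y Y'),
    linear (fun f : hom X X' => f \oxm g);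
  tensm_linearr : forall (X X' Y Y' : st_cat) (f : hom X X'),
    linear (fun g : hom Y Y' => f \oxm g);
  tensm_exactl : forall (X Y Z W : st_cat) (i : hom X Y) (p : hom Y Z),
    short_exact i p -> short_exact (i \oxm idm W) (p \oxm idm W);
  tensm_exactr : forall (X Y Z W : st_cat) (i : hom X Y) (p : hom Y Z),
    short_exact i p -> short_exact (idm W \oxm i) (idm W \oxm p);

  tunit : st_cat;
  asso : forall X Y Z : st_cat, hom ((X \ox Y) \ox Z) (X \ox (Y \ox Z));
  assoV : forall X Y Z : st_cat, hom (X \ox (Y \ox Z)) ((X \ox Y) \ox Z);
  assoK : forall X Y Z, assoV X Y Z \oc asso X Y Z = idm _;
  assoVK : forall X Y Z, asso X Y Z \oc assoV X Y Z = idm _;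
  asso_nat : forall (X X' Y Y' Z Z' : st_cat)
    (f : hom X X') (g : hom Y Y') (h : hom Z Z'),
    asso X' Y' Z' \oc ((f \oxm g) \oxm h) =
    (f \oxm (g \oxm h)) \oc asso X Y Z;
  lunit : forall X : st_cat, hom (tunit \ox X) X;
  lunitV : forall X : st_cat, hom X (tunit \ox X);
  lunitK : forall X, lunitV X \oc lunit X = idm _;
  lunitVK : forall X, lunit X \oc lunitV X = idm _;
  lunit_nat : forall (X X' : st_cat) (f : hom X X'),
    lunit X' \oc (idm tunit \oxm f) = f \oc lunit X;
  runit : forall X : st_cat, hom (X \ox tunit) X;
  runitV : forall X : st_cat, hom X (X \ox tunit);
  runitK : forall X, runitV X \oc runit X = idm _;
  runitVK : forall X, runit X \oc runitV X = idm _;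
  runit_nat : forall (X X' : st_cat) (f : hom X X'),
    runit X' \oc (f \oxm idm tunit) = f \oc runit X;
  pentagon : forall X Y Z W : st_cat,
    asso X Y (Z \ox W) \oc asso (X \ox Y) Z W =
    (idm X \oxm asso Y Z W) \oc asso X (Y \ox Z) W
      \oc (asso X Y Z \oxm idm W);
  triangle : forall X Y : st_cat,
    (idm X \oxm lunit Y) \oc asso X tunit Y = runit X \oxm idm Y;

  symm : forall X Y : st_cat, hom (X \ox Y) (Y \ox X);
  symm_nat : forall (X X' Y Y' : st_cat) (f : hom X X') (g : hom Y Y'),
    symm X' Y' \oc (f \oxm g) = (g \oxm f) \oc symm X Y;
  symmK : forall X Y, symm Y X \oc symm X Y = idm (X \ox Y);
  hexagon : forall X Y Z : st_cat,
    asso Y Z X \oc symm X (Y \ox Z) \oc asso X Y Z =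
    (idm Y \oxm symm X Z) \oc asso Y X Z \oc (symm X Y \oxm idm Z)
}.

Arguments tens {k s} X Y.
Arguments tensm {k s X X' Y Y'} f g.
Arguments tunit {k} s.
Arguments asso {k s} X Y Z.
Arguments assoV {k s} X Y Z.
Arguments lunit {k s} X.
Arguments lunitV {k s} X.
Arguments runit {k s} X.
Arguments runitV {k s} X.
Arguments symm {k s} X Y.
Notation "X \ox Y" := (tens X Y) : tcat_scope.
Notation "f \oxm g" := (tensm f g) : tcat_scope.

Record algObj (k : fieldType) (C : symTensorCat k) : Type := AlgObj {
  alg_obj :> C;
  amul : hom (alg_obj \ox alg_obj) alg_obj;
  aone : hom (tunit C) alg_obj;
  amulA : amul \oc (amul \oxm idm alg_obj) =
    amul \oc (idm alg_obj \oxm amul) \oc asso alg_obj alg_obj alg_obj;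
  amul1l : amul \oc (aone \oxm idm alg_obj) = lunit alg_obj;
  amul1r : amul \oc (idm alg_obj \oxm aone) = runit alg_obj
}.

Arguments amul {k C} A : rename.
Arguments aone {k C} A : rename.

Section Subobjects.
Variables (k : fieldType) (C : abelianCat k).

Record subobj (A : C) : Type := SubObj {
  sub_dom : C;
  sub_mor : hom sub_dom A;
  sub_mono : mono sub_mor
}.

Definition sub_le (A : C) (S T : subobj A) : Prop :=
  exists h : hom (sub_dom S) (sub_dom T), sub_mor T \oc h = sub_mor S.

Lemma idm_mono (A : C) : mono (idm A).
Proof. by move=> T u v; rewrite !comp_idl. Qed.

Definition sub_full (A : C) : subobj A := SubObj (@idm_mono A).

Definition image (X A : C) (f : hom X A) : subobj A :=
  SubObj (kernel_mono (kerP (coker f))).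

End Subobjects.

Section LowerCentralSeries.
Variables (k : fieldType) (C : symTensorCat k) (A : algObj C).

Definition commutator : hom (A \ox A) A := amul A \oc (idm (A \ox A) - symm A A).

Definition sub_comm (X Y : subobj (A : C)) : subobj (A : C) :=
  image (commutator \oc (sub_mor X \oxm sub_mor Y)).

Definition sub_mul (X Y : subobj (A : C)) : subobj (A : C) :=
  image (amul A \oc (sub_mor X \oxm sub_mor Y)).

(* Indexed from 1; the value at index 0 is A by convention. *)
Fixpoint lcs (i : nat) : subobj (A : C) :=
  match i with
  | i'.+1 => if i' is _.+1 then sub_comm (sub_full (A : C)) (lcs i')
             else sub_full (A : C)
  | 0 => sub_full (A : C)
  end.

(* A L_i is already stable under right multiplication, because
   L_i A is contained in A L_i + [A, L_i] and L_(i+1) in L_i. *)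
Definition lcs_ideal (i : nat) : subobj (A : C) :=
  sub_mul (sub_full (A : C)) (lcs i).

End LowerCentralSeries.

(* Main.v *)
(** By the Jacobi identity it suffices to show that [A L_j, A] lies in L_(j+1)
    for odd j, which goes by induction on j, computing modulo L_(j+1).

    In general [b, a [p, u]] = - [b, p [a, u]] for u in L_(j-1).  If j >= 5, take
    u = [x, v] with v in L_(j-2).  With w = [p, x] in L_2,
      a [w, v] = [w, a v] + [a, w] v,
    and the cases j - 2 and 3 of the theorem give [b, a [w, v]] = 0, so that
    [b, a [p, [x, v]]] is symmetric in p, x; being antisymmetric in a, p, it
    vanishes.  If j = 3, the class of [b, a [p, [x, y]]] is alternating in b, a, p,
    antisymmetric in x, y, and satisfies the Jacobi identity in p, x, y.  It is
    thus a curvature tensor in a, p | x, y, hence symmetric under exchange of the two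
    pairs, hence alternating in all five variables, and Jacobi kills it.

    An element of A is replaced by a morphism f : X -> A, and permutations of the
    variables by composites of [swap X Y Z : X (Y Z) -> Y (X Z)]. *)
From mathcomp Require Import all_boot all_order all_algebra.
Require Import Defs.

Set Implicit Arguments.
Unset Strict Implicit.
Unset Printing Implicit Defensive.

Import GRing.Theory.
Local Open Scope ring_scope.
Local Open Scope tcat_scope.

(** * Bilinearity of composition *)

Section LinearCategories.
Variables (k : fieldType) (C : linearCat k).
Implicit Types X Y Z : C.

Lemma compDl X Y Z (g g' : hom Y Z) (f : hom X Y) :
  (g + g') \oc f = g \oc f + g' \oc f.
Proof. by have := comp_linearl (Z := Z) f 1 g g'; rewrite !scale1r. Qed.

Lemma compDr X Y Z (g : hom Y Z) (f f' : hom X Y) :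
  g \oc (f + f') = g \oc f + g \oc f'.
Proof. by have := comp_linearr (X := X) g 1 f f'; rewrite !scale1r. Qed.

Lemma comp0l X Y Z (f : hom X Y) : (0 : hom Y Z) \oc f = 0.
Proof. by apply: (addrI (0 \oc f)); rewrite -compDl !addr0. Qed.

Lemma comp0r X Y Z (g : hom Y Z) : g \oc (0 : hom X Y) = 0.
Proof. by apply: (addrI (g \oc 0)); rewrite -compDr !addr0. Qed.

Lemma compNl X Y Z (g : hom Y Z) (f : hom X Y) : (- g) \oc f = - (g \oc f).
Proof. by apply: (addrI (g \oc f)); rewrite -compDl !subrr comp0l. Qed.

Lemma compNr X Y Z (g : hom Y Z) (f : hom X Y) : g \oc (- f) = - (g \oc f).
Proof. by apply: (addrI (g \oc f)); rewrite -compDr !subrr comp0r. Qed.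

Lemma epi_comp X Y Z (g : hom Y Z) (f : hom X Y) :
  epi g -> epi f -> epi (g \oc f).
Proof. by move=> eg ef T u v; rewrite !compA => /ef/eg. Qed.

Lemma cokernel_epi X Y Z (p : hom Y Z) (f : hom X Y) : is_cokernel p f -> epi p.
Proof.
move=> [pf0 univ] T u v upvp.
have /univ[h [_ hP]] : (u \oc p) \oc f = 0 by rewrite -compA pf0 comp0r.
by rewrite -(hP u erefl) (hP v).
Qed.

End LinearCategories.

(** * Epimorphisms and images in abelian categories *)

Section AbelianCategories.
Variables (k : fieldType) (C : abelianCat k).
Implicit Types X Y Z : C.

(** [p] is the cokernel of some [f], and [f] factors through [ker p]. This completes an epimorphism
    to a short exact sequence, to which exactness of the tensor product applies. *)
Lemma epi_cokernel_ker X Y (p : hom X Y) : epi p -> is_cokernel p (ker p).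
Proof.
move=> ep; have [Z [f [pf0 univ]]] := epi_normal ep.
have [pk0 kuniv] := kerP p; split=> // T t tk0.
have [h [kh _]] := kuniv _ _ pf0.
by apply: univ; rewrite -kh compA tk0 comp0l.
Qed.

Lemma epi_short_exact X Y (p : hom X Y) : epi p -> short_exact (ker p) p.
Proof. by move=> ep; split; [exact: kerP | exact: epi_cokernel_ker]. Qed.

(** If [w] kills [e], then [f] factors through [ker w], which is a subobject of [Y] and so the
    kernel of some [g]. As [g] kills [f], it kills the image; hence [ker w] has a section and
    [w = 0]. *)
Lemma image_factor X Y (f : hom X Y) :
  exists2 e : hom X (sub_dom (image f)), epi e & sub_mor (image f) \oc e = f.
Proof.
have [_ cuniv] := cokerP f; have [ci0 iuniv] := kerP (coker f).
have [e [ie _]] := iuniv _ _ (cokerP f).1.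
exists e => // T u v uv; apply/eqP; rewrite -subr_eq0; apply/eqP.
have we0 : (u - v) \oc e = 0 by rewrite compDl compNl uv subrr.
move: (u - v) we0 => w we0 {u v uv}.
have [wk0 kuniv] := kerP w.
have mk : mono (ker (coker f) \oc ker w).
  move=> S a b; rewrite -!compA => /(kernel_mono (kerP (coker f))).
  exact: (kernel_mono (kerP w)).
have [Z [g [gk0 guniv]]] := mono_normal mk.
have [e' [ke' _]] := kuniv _ _ we0.
have gf0 : g \oc f = 0 by rewrite -ie -ke' !compA -(compA g) gk0 comp0l.
have [g' [gE _]] := cuniv _ _ gf0.
have gi0 : g \oc ker (coker f) = 0 by rewrite -gE -compA ci0 comp0r.
have [h [hE _]] := guniv _ _ gi0.
have kh : ker w \oc h = idm _.
  by apply: (kernel_mono (kerP (coker f))); rewrite compA hE comp_idr.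
by rewrite -[w]comp_idr -kh compA wk0 comp0l.
Qed.

Lemma image_factorP X Y Z (f : hom X Y) (g : hom Z Y) :
  (exists h, sub_mor (image f) \oc h = g) <-> coker f \oc g = 0.
Proof.
have [ci0 iuniv] := kerP (coker f).
split=> [[h <-]|/iuniv[h [hE _]]]; last by exists h.
by rewrite compA ci0 comp0l.
Qed.

End AbelianCategories.

(** * Permutations of tensor factors *)

Section TensorCategories.
Variables (k : fieldType) (C : symTensorCat k).
Implicit Types X Y Z T : C.

Lemma tensmDl X X' Y Y' (f f' : hom X X') (g : hom Y Y') :
  (f + f') \oxm g = f \oxm g + f' \oxm g.
Proof. by have := tensm_linearl g 1 f f'; rewrite !scale1r. Qed.

Lemma tensmDr X X' Y Y' (f : hom X X') (g g' : hom Y Y') :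
  f \oxm (g + g') = f \oxm g + f \oxm g'.
Proof. by have := tensm_linearr f 1 g g'; rewrite !scale1r. Qed.

Lemma tensm0l X X' Y Y' (g : hom Y Y') : (0 : hom X X') \oxm g = 0.
Proof. by apply: (addrI (0 \oxm g)); rewrite -tensmDl !addr0. Qed.

Lemma tensm0r X X' Y Y' (f : hom X X') : f \oxm (0 : hom Y Y') = 0.
Proof. by apply: (addrI (f \oxm 0)); rewrite -tensmDr !addr0. Qed.

Lemma tensmNl X X' Y Y' (f : hom X X') (g : hom Y Y') :
  (- f) \oxm g = - (f \oxm g).
Proof. by apply: (addrI (f \oxm g)); rewrite -tensmDl !subrr tensm0l. Qed.

Lemma tensmNr X X' Y Y' (f : hom X X') (g : hom Y Y') :
  f \oxm (- g) = - (f \oxm g).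
Proof. by apply: (addrI (f \oxm g)); rewrite -tensmDr !subrr tensm0r. Qed.

Lemma tensm_compl X X' X'' Y Y' (f' : hom X' X'') (f : hom X X') (g : hom Y Y') :
  (f' \oc f) \oxm g = (f' \oxm g) \oc (f \oxm idm Y).
Proof. by rewrite -tensm_comp comp_idr. Qed.

Lemma tensm_compr X X' Y Y' Y'' (f : hom X X') (g' : hom Y' Y'') (g : hom Y Y') :
  f \oxm (g' \oc g) = (f \oxm g') \oc (idm X \oxm g).
Proof. by rewrite -tensm_comp comp_idr. Qed.

Lemma epi_tensml X Y T (e : hom X Y) : epi e -> epi (e \oxm idm T).
Proof. by move=> /epi_short_exact/(tensm_exactl T)[_] /cokernel_epi. Qed.

Lemma epi_tensmr X Y T (e : hom X Y) : epi e -> epi (idm T \oxm e).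
Proof. by move=> /epi_short_exact/(tensm_exactr T)[_] /cokernel_epi. Qed.

Lemma assoV_nat X X' Y Y' Z Z' (f : hom X X') (g : hom Y Y') (h : hom Z Z') :
  ((f \oxm g) \oxm h) \oc assoV X Y Z = assoV X' Y' Z' \oc (f \oxm (g \oxm h)).
Proof.
rewrite -[LHS]comp_idl -(assoK X' Y' Z') -compA (compA (asso _ _ _)) asso_nat.
by rewrite -!compA assoVK comp_idr.
Qed.

(* [swap], [asso4], [mul] and [brk] are locked so that rewriting with [compA]
   does not see through them. *)
Definition swap X Y Z : hom (X \ox (Y \ox Z)) (Y \ox (X \ox Z)) :=
  locked (asso Y X Z \oc (symm X Y \oxm idm Z) \oc assoV X Y Z).

Lemma swapE X Y Z :
  swap X Y Z = asso Y X Z \oc (symm X Y \oxm idm Z) \oc assoV X Y Z.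
Proof. by rewrite /swap -lock. Qed.

Lemma swap_nat X X' Y Y' Z Z' (f : hom X X') (g : hom Y Y') (h : hom Z Z') :
  swap X' Y' Z' \oc (f \oxm (g \oxm h)) = (g \oxm (f \oxm h)) \oc swap X Y Z.
Proof.
rewrite !swapE -compA -assoV_nat compA -(compA (asso _ _ _)) -tensm_comp symm_nat.
by rewrite comp_idl -[h in LHS]comp_idr tensm_comp !compA asso_nat.
Qed.

Lemma swapK X Y Z : swap Y X Z \oc swap X Y Z = idm _.
Proof.
rewrite !swapE -!compA (compA (assoV Y X Z)) assoK comp_idl.
rewrite (compA (symm Y X \oxm _)) -tensm_comp symmK comp_idl tensm_id comp_idl.
exact: assoVK.
Qed.

Lemma symm_tens X Y Z :
  asso Y Z X \oc symm X (Y \ox Z) = (idm Y \oxm symm X Z) \oc swap X Y Z.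
Proof.
by rewrite !swapE !compA -hexagon -!compA assoVK comp_idr.
Qed.

(** Both sides move [X] past [Y] and [Z] and exchange [Y] with [Z]; by naturality of [symm] the
    order of these two operations does not matter. *)
Lemma swap_symm_braid X Y Z :
  (idm Z \oxm symm X Y) \oc swap X Z Y \oc (idm X \oxm symm Y Z) =
  swap Y Z X \oc (idm Y \oxm symm X Z) \oc swap X Y Z.
Proof.
rewrite -symm_tens -compA symm_nat -compA -symm_tens !swapE !compA.
by rewrite -!(compA _ (assoV _ _ _)) assoK comp_idr.
Qed.

Definition asso4 X Y Z T : hom ((X \ox (Y \ox Z)) \ox T) (X \ox (Y \ox (Z \ox T))) :=
  locked ((idm X \oxm asso Y Z T) \oc asso X (Y \ox Z) T).

Lemma asso4_epi X Y Z T : epi (asso4 X Y Z T).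
Proof.
suff E : asso4 X Y Z T \oc (assoV X (Y \ox Z) T \oc (idm X \oxm assoV Y Z T)) = idm _.
  by move=> S u v uv; rewrite -[u]comp_idr -[v]comp_idr -E !(compA _ (asso4 _ _ _ _)) uv.
rewrite /asso4 -!lock -compA (compA (asso _ _ _)) assoVK comp_idl -tensm_comp assoVK.
by rewrite comp_idl tensm_id.
Qed.

(** The pentagon gives the route through [(X Y) (Z T)], along which [symm X Y] slides by
    naturality. *)
Lemma asso4E X Y Z T : asso4 X Y Z T =
  asso X Y (Z \ox T) \oc asso (X \ox Y) Z T \oc (assoV X Y Z \oxm idm T).
Proof.
by rewrite pentagon /asso4 -lock -!compA -tensm_comp assoVK comp_idl tensm_id comp_idr.
Qed.

Lemma swap_asso4 X Y Z T :
  swap X Y (Z \ox T) \oc asso4 X Y Z T = asso4 Y X Z T \oc (swap X Y Z \oxm idm T).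
Proof.
rewrite asso4E !swapE !compA -!(compA _ (assoV _ _ (Z \ox T))) assoK comp_idr.
rewrite 2!tensm_compl /asso4 -!lock !compA -pentagon -!(compA _ ((symm X Y \oxm _) \oxm _)).
by rewrite -!compA (compA (asso (Y \ox X) Z T)) asso_nat tensm_id !compA.
Qed.

Lemma swap_asso4_in X Y Z T :
  (idm X \oxm swap Y Z T) \oc asso4 X Y Z T =
  asso4 X Z Y T \oc ((idm X \oxm symm Y Z) \oxm idm T).
Proof.
rewrite /asso4 -!lock -[RHS]compA asso_nat !compA -!tensm_comp !swapE.
by rewrite -(compA _ (assoV _ _ _)) assoK !comp_idr.
Qed.

(** Precomposition with the epimorphism [asso4] moves [T] out of every [swap], leaving
    [swap_symm_braid] tensored with [idm T]. *)
Lemma swap_braid X Y Z T :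
  (idm Z \oxm swap X Y T) \oc swap X Z (Y \ox T) \oc (idm X \oxm swap Y Z T) =
  swap Y Z (X \ox T) \oc (idm Y \oxm swap X Z T) \oc swap X Y (Z \ox T).
Proof.
apply: (@asso4_epi X Y Z T _).
rewrite -!compA swap_asso4_in swap_asso4.
rewrite (compA (swap X Z _)) swap_asso4 (compA (idm Y \oxm _)) swap_asso4_in.
rewrite -!compA (compA (idm Z \oxm _)) swap_asso4_in (compA (swap Y Z _)) swap_asso4.
by rewrite -!compA -!tensm_compl !compA swap_symm_braid.
Qed.

End TensorCategories.

(** * Commutator identities in an associative algebra *)

Section AlgebraIdentities.
Variables (k : fieldType) (C : symTensorCat k) (A : algObj C).
Implicit Types X Y Z T : C.

Definition mul X Y (f : hom X A) (g : hom Y A) : hom (X \ox Y) A :=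
  locked (amul A \oc (f \oxm g)).
Definition brk X Y (f : hom X A) (g : hom Y A) : hom (X \ox Y) A :=
  locked (commutator A \oc (f \oxm g)).

Lemma mul_comp X X' Y Y' (f : hom X' A) (g : hom Y' A) (u : hom X X') (v : hom Y Y') :
  mul (f \oc u) (g \oc v) = mul f g \oc (u \oxm v).
Proof. by rewrite /mul -!lock tensm_comp compA. Qed.

Lemma brk_comp X X' Y Y' (f : hom X' A) (g : hom Y' A) (u : hom X X') (v : hom Y Y') :
  brk (f \oc u) (g \oc v) = brk f g \oc (u \oxm v).
Proof. by rewrite /brk -!lock tensm_comp compA. Qed.

Lemma brk_compr X Y Y' (f : hom X A) (g : hom Y' A) (v : hom Y Y') :
  brk f (g \oc v) = brk f g \oc (idm X \oxm v).
Proof. by rewrite -brk_comp comp_idr. Qed.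

Lemma mul_compr X Y Y' (f : hom X A) (g : hom Y' A) (v : hom Y Y') :
  mul f (g \oc v) = mul f g \oc (idm X \oxm v).
Proof. by rewrite -mul_comp comp_idr. Qed.

Lemma brk_compl X X' Y (f : hom X' A) (g : hom Y A) (u : hom X X') :
  brk (f \oc u) g = brk f g \oc (u \oxm idm Y).
Proof. by rewrite -brk_comp comp_idr. Qed.

Lemma brkDr X Y (f : hom X A) (g g' : hom Y A) : brk f (g + g') = brk f g + brk f g'.
Proof. by rewrite /brk -!lock tensmDr compDr. Qed.

Lemma brkDl X Y (f f' : hom X A) (g : hom Y A) : brk (f + f') g = brk f g + brk f' g.
Proof. by rewrite /brk -!lock tensmDl compDr. Qed.

Lemma brkNr X Y (f : hom X A) (g : hom Y A) : brk f (- g) = - brk f g.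
Proof. by rewrite /brk -!lock tensmNr compNr. Qed.

Lemma brkNl X Y (f : hom X A) (g : hom Y A) : brk (- f) g = - brk f g.
Proof. by rewrite /brk -!lock tensmNl compNr. Qed.

Lemma mulDr X Y (f : hom X A) (g g' : hom Y A) : mul f (g + g') = mul f g + mul f g'.
Proof. by rewrite /mul -!lock tensmDr compDr. Qed.

Lemma mulDl X Y (f f' : hom X A) (g : hom Y A) : mul (f + f') g = mul f g + mul f' g.
Proof. by rewrite /mul -!lock tensmDl compDr. Qed.

Lemma mulNl X Y (f : hom X A) (g : hom Y A) : mul (- f) g = - mul f g.
Proof. by rewrite /mul -!lock tensmNl compNr. Qed.

Lemma mulNr X Y (f : hom X A) (g : hom Y A) : mul f (- g) = - mul f g.
Proof. by rewrite /mul -!lock tensmNr compNr. Qed.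

Lemma commutator_symm : commutator A \oc symm A A = - commutator A.
Proof.
by rewrite /commutator -compA compDl comp_idl compNl symmK -opprB compNr.
Qed.

Lemma brk_symm X Y (f : hom X A) (g : hom Y A) : brk g f \oc symm X Y = - brk f g.
Proof.
by rewrite /brk -!lock -compA -symm_nat compA commutator_symm compNl.
Qed.

Lemma brkE X Y (f : hom X A) (g : hom Y A) : brk f g = mul f g - mul g f \oc symm X Y.
Proof.
rewrite /brk /mul -!lock /commutator -compA compDl comp_idl compNl compDr compNr.
by rewrite symm_nat !compA.
Qed.

Lemma mulA X Y Z (f : hom X A) (g : hom Y A) (h : hom Z A) :
  mul (mul f g) h = mul f (mul g h) \oc asso X Y Z.
Proof.
rewrite /mul -!lock -[h in LHS]comp_idl -[f in RHS]comp_idl !tensm_comp !compA amulA.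
by rewrite -!compA asso_nat.
Qed.

Lemma mulAV X Y Z (f : hom X A) (g : hom Y A) (h : hom Z A) :
  mul (mul f g) h \oc assoV X Y Z = mul f (mul g h).
Proof. by rewrite mulA -compA assoVK comp_idr. Qed.

(* The lemmas [*_expand] use right-nested products of the permuted factors,
   precomposed with a word in [swap] and [idm _ \oxm symm _ _], as normal form. *)
Lemma mul_brk_expand X Y Z (f : hom X A) (g : hom Y A) (h : hom Z A) :
  mul f (brk g h) = mul f (mul g h) - mul f (mul h g) \oc (idm X \oxm symm Y Z).
Proof. by rewrite brkE mulDr mulNr mul_compr. Qed.

Lemma mul_swap X Y Z (f : hom X A) (g : hom Y A) (h : hom Z A) :
  mul (mul g f \oc symm X Y) h \oc assoV X Y Z = mul g (mul f h) \oc swap X Y Z.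
Proof.
by rewrite -[h in LHS]comp_idr mul_comp mulA !swapE !compA.
Qed.

Lemma brk_mul_expand X Y Z (f : hom X A) (g : hom Y A) (h : hom Z A) :
  mul (brk f g) h \oc assoV X Y Z = mul f (mul g h) - mul g (mul f h) \oc swap X Y Z.
Proof.
by rewrite brkE -mul_swap -mulAV mulDl mulNl compDl compNl.
Qed.

Lemma brk_mulr_expand X Y Z (f : hom X A) (g : hom Y A) (h : hom Z A) :
  brk f (mul g h) = mul f (mul g h) -
    mul g (mul h f) \oc ((idm Y \oxm symm X Z) \oc swap X Y Z).
Proof. by rewrite brkE mulA -symm_tens !compA. Qed.

(** The second hexagon, obtained from [symm_tens] by inverting the symmetries. *)
Lemma symm_tensV X Y Z :
  symm (X \ox Y) Z \oc assoV X Y Z = swap X Z Y \oc (idm X \oxm symm Y Z).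
Proof.
rewrite -[LHS]comp_idl -(swapK Z X Y) -[swap Z X Y]comp_idl -tensm_id -(symmK Z Y).
rewrite tensm_compr -[_ \oc _ \oc swap Z X Y]compA -symm_tens -!compA.
by rewrite (compA (symm _ _) (symm _ _)) symmK comp_idl assoVK comp_idr.
Qed.

Lemma brk_mull_expand X Y Z (f : hom X A) (g : hom Y A) (h : hom Z A) :
  brk (mul f g) h \oc assoV X Y Z = mul f (mul g h) -
    mul h (mul f g) \oc (swap X Z Y \oc (idm X \oxm symm Y Z)).
Proof. by rewrite brkE compDl compNl mulAV -symm_tensV compA. Qed.

Lemma leibniz X Y Z (a : hom X A) (u : hom Y A) (p : hom Z A) :
  mul a (brk u p) = brk u (mul a p) \oc swap X Y Z + mul (brk a u) p \oc assoV X Y Z.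
Proof.
rewrite mul_brk_expand brk_mul_expand brk_mulr_expand compDl compNl -!compA swapK.
by rewrite comp_idr (addrC (_ - _)) addrA subrK.
Qed.

Lemma brk_brk_expand X Y Z (f : hom X A) (g : hom Y A) (h : hom Z A) :
  brk f (brk g h) = mul f (mul g h)
    - mul g (mul h f) \oc ((idm Y \oxm symm X Z) \oc swap X Y Z)
    - mul f (mul h g) \oc (idm X \oxm symm Y Z)
    + mul h (mul g f) \oc (swap Y Z X \oc ((idm Y \oxm symm X Z) \oc swap X Y Z)).
Proof.
rewrite (brkE g) brkDr brkNr brk_compr !brk_mulr_expand compDl compNl opprB.
rewrite -!compA (compA (idm Z \oxm _)) -(compA (idm Z \oxm _)).
by rewrite (compA _ (swap X Z Y)) swap_symm_braid -compA addrA (addrAC _ _ (- _)).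
Qed.

(** For [l] in L_i the right side lies in L_(i+1), so modulo L_(i+1) the commutator [b, a l] is
    antisymmetric in [a], [b]. *)
Lemma brk_mul_swap X Y Z (b : hom X A) (a : hom Y A) (l : hom Z A) :
  brk b (mul a l) + brk a (mul b l) \oc swap X Y Z =
  brk (mul b a) l \oc assoV X Y Z + brk a (brk b l) \oc swap X Y Z.
Proof.
rewrite brk_mull_expand brk_brk_expand !brk_mulr_expand.
rewrite !compDl !compNl -!compA swapK comp_idr.
by rewrite -(addrA _ (- (mul l _ \oc _))) (addrC (- (mul l _ \oc _))) addrK -addrA (addrC (- _)).
Qed.

(** For [u] in L_i the right side lies in L_(i+1); a further bracket with [b] makes [b, a [p, u]]
    antisymmetric in [a], [p] modulo L_(i+2). *)
Lemma mul_brk_swap X Y Z (a : hom X A) (p : hom Y A) (u : hom Z A) :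
  mul a (brk p u) + mul p (brk a u) \oc swap X Y Z =
  brk (mul a p) u \oc assoV X Y Z + brk p (brk a u) \oc swap X Y Z.
Proof.
rewrite brk_mull_expand brk_brk_expand !mul_brk_expand.
rewrite !compDl !compNl -!compA swapK comp_idr.
by rewrite -(addrA _ (- (mul u _ \oc _))) (addrC (- (mul u _ \oc _))) addrK -addrA (addrC (- _))
  (addrAC _ (- _)).
Qed.

Lemma brk_brkl_expand X Y Z (f : hom X A) (g : hom Y A) (h : hom Z A) :
  brk (brk f g) h \oc assoV X Y Z =
  brk (mul f g) h \oc assoV X Y Z - brk (mul g f) h \oc assoV Y X Z \oc swap X Y Z.
Proof.
rewrite (brkE f) brkDl brkNl compDl compNl brk_compl; congr (_ - _).
by rewrite swapE -!compA (compA (assoV _ _ _)) assoK comp_idl.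
Qed.

Lemma jacobi X Y Z (x : hom X A) (y : hom Y A) (z : hom Z A) :
  brk x (brk y z) =
  brk (brk x y) z \oc assoV X Y Z + brk y (brk x z) \oc swap X Y Z.
Proof.
rewrite brk_brkl_expand !brk_mull_expand !brk_brk_expand.
rewrite !compDl !compNl -!compA swapK comp_idr.
by rewrite opprB !addrA subrK [RHS](ACl (1*5*4*3*(2*6))) /= addNr addr0.
Qed.

End AlgebraIdentities.

(** * Generalized elements of the lower central series *)

Section LowerCentralSeries.
Variables (k : fieldType) (C : symTensorCat k) (A : algObj C).
Implicit Types X Y Z T : C.

Definition inL (i : nat) X (f : hom X A) : Prop :=
  exists h, sub_mor (lcs A i) \oc h = f.

Lemma inL_lcs i : inL i (sub_mor (lcs A i)).
Proof. by exists (idm _); rewrite comp_idr. Qed.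

Lemma inL1 X (f : hom X A) : inL 1 f.
Proof. by exists f; rewrite comp_idl. Qed.

Lemma inL_comp i X Y (f : hom Y A) (u : hom X Y) : inL i f -> inL i (f \oc u).
Proof. by move=> [h <-]; exists (h \oc u); rewrite compA. Qed.

Lemma inLD i X (f g : hom X A) : inL i f -> inL i g -> inL i (f + g).
Proof. by move=> [h <-] [h' <-]; exists (h + h'); rewrite compDr. Qed.

Lemma inLN i X (f : hom X A) : inL i f -> inL i (- f).
Proof. by move=> [h <-]; exists (- h); rewrite compNr. Qed.

Lemma inLB i X (f g : hom X A) : inL i f -> inL i g -> inL i (f - g).
Proof. by move=> fL gL; apply: inLD => //; apply: inLN. Qed.

(** The projection from [A] onto its quotient by [lcs A i.+2], which turns membership into the
    vanishing of a composite. *)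
Definition lcs_quot i :=
  coker (commutator A \oc (idm (A : C) \oxm sub_mor (lcs A i.+1))).

Lemma inL_quot i X (f : hom X A) : inL i.+2 f <-> lcs_quot i \oc f = 0.
Proof. exact: image_factorP. Qed.

(** Vanishing in the quotient can be tested after an epimorphism, so membership may be checked on
    generators; at indices 0 and 1 the subobject is all of [A]. *)
Lemma inL_epi i X Y (f : hom Y A) (e : hom X Y) : epi e -> inL i (f \oc e) -> inL i f.
Proof.
case: i => [|[|i]] ee; try by move=> _; exact: inL1.
by move=> /inL_quot; rewrite compA => fe0; apply/inL_quot/ee; rewrite fe0 comp0l.
Qed.

Lemma lcs_cover i : exists2 e, epi e &
  sub_mor (lcs A i.+2) \oc e = brk (idm (A : C)) (sub_mor (lcs A i.+1)).
Proof. by rewrite /brk -lock; exact: image_factor. Qed.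

Lemma inL_brk1 i X Y (x : hom X A) (f : hom Y A) : inL i.+1 f -> inL i.+2 (brk x f).
Proof.
move=> [h <-]; rewrite -[x]comp_idl brk_comp; apply: inL_comp.
by have [e _ <-] := lcs_cover i; apply: inL_comp; exact: inL_lcs.
Qed.

Lemma inL_pred i X (f : hom X A) : inL i.+1 f -> inL i f.
Proof.
case: i => [|i] // [h <-]; apply: inL_comp => {X f h}.
elim: i => [|i IH]; first exact: inL1.
have [e ee eE] := lcs_cover i.+1; apply: (inL_epi ee); rewrite eE.
exact: inL_brk1.
Qed.

Lemma inL_brk1l i X Y (x : hom X A) (f : hom Y A) : inL i.+1 f -> inL i.+2 (brk f x).
Proof.
move=> fL; rewrite -[brk f x]opprK -brk_symm.
by apply/inLN/inL_comp/inL_brk1.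
Qed.

(** Reduction to the generic generator of L_(i+2): the cover of L_(i+2) stays epi after
    tensoring. *)
Lemma inL_brk_ind i n X Y (x : hom X A) (f : hom Y A) : inL i.+2 f ->
  inL n (brk x (brk (idm (A : C)) (sub_mor (lcs A i.+1)))) -> inL n (brk x f).
Proof.
move=> [h <-] xL; rewrite brk_compr; apply: inL_comp.
have [e ee eE] := lcs_cover i.
by apply: (inL_epi (epi_tensmr ee)); rewrite -brk_compr eE.
Qed.

(** Induction on [j] through [f, [x, l]] = [[f, x], l] + [x, [f, l]]. *)
Lemma inL_brk i j X Y (f : hom X A) (g : hom Y A) :
  inL i.+1 f -> inL j.+1 g -> inL (i + j).+2 (brk f g).
Proof.
elim: j i X Y f g => [|j IH] i X Y f g fL gL; first by rewrite addn0; apply: inL_brk1l.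
apply: (inL_brk_ind gL); rewrite jacobi.
apply: inLD; apply: inL_comp.
  by rewrite -addSnnS; apply: IH (inL_lcs _); apply: inL_brk1l.
by rewrite addnS; apply/inL_brk1/IH/inL_lcs.
Qed.

(* [M_(i+1), L_(j+1)] is contained in L_(i+j+2). *)
Definition brk_ideal_sub i j := forall X Y Z (a : hom X A) (f : hom Y A) (g : hom Z A),
  inL i.+1 f -> inL j.+1 g -> inL (i + j).+2 (brk (mul a f) g).

(** The same induction with [mul a f] in place of [f]; the hypothesis puts [a f, x] in L_(i+2), so
    [inL_brk] handles [[a f, x], l]. *)
Lemma brk_ideal_sub_ind i : brk_ideal_sub i 0 -> forall j, brk_ideal_sub i j.
Proof.
move=> H0; elim=> // j IH X Y Z a f g fL gL.
apply: (inL_brk_ind gL); rewrite jacobi.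
apply: inLD; apply: inL_comp.
  rewrite addnS -addSn; apply: inL_brk (inL_lcs _).
  by rewrite -[i in inL i.+2]addn0; apply: H0 => //; exact: inL1.
by rewrite addnS; apply: inL_brk1; apply: IH => //; exact: inL_lcs.
Qed.

Lemma brk_ideal_sub1 j : brk_ideal_sub 0 j.
Proof. by apply: brk_ideal_sub_ind => X Y Z a f g _ _; apply/inL_brk1/inL1. Qed.

Lemma inL_brkC n X Y (f : hom X A) (g : hom Y A) : inL n (brk g f) -> inL n (brk f g).
Proof. by move=> gfL; rewrite -[brk f g]opprK -brk_symm; apply/inLN/inL_comp. Qed.

(** Every factor is replaced by its universal instance: L_(i+3) is covered by A (A L_(i+1)) via two
    successive covers, and the other variables become identities. *)
Lemma brk_ideal_sub_cover i :
  let a := idm (A : C) in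
  inL i.+4 (brk a (mul a (brk a (brk a (sub_mor (lcs A i.+1)))))) ->
  brk_ideal_sub i.+2 0.
Proof.
move=> a aL X Y Z b f c [h <-] _; rewrite addn0; apply: inL_brkC.
rewrite -[b]comp_idl -[c]comp_idl mul_comp brk_comp; apply: inL_comp.
have [e ee eE] := lcs_cover i; have [e' ee' eE'] := lcs_cover i.+1.
have E : epi (a \oxm (a \oxm (e' \oc (a \oxm e)))).
  by do 2!apply: epi_tensmr; apply/(epi_comp ee')/epi_tensmr.
by apply: (inL_epi E); rewrite -brk_compr -mul_compr compA eE' -brk_compr eE.
Qed.

Lemma inL_mul_brk_swap i X Y Z T
    (b : hom X A) (a : hom Y A) (p : hom Z A) (u : hom T A) : inL i.+1 u ->
  inL i.+3 (brk b (mul a (brk p u)) +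
            brk b (mul p (brk a u)) \oc (idm X \oxm swap Y Z T)).
Proof.
move=> uL; rewrite -brk_compr -brkDr mul_brk_swap; apply: inL_brk1.
apply: inLD; apply: inL_comp; apply: inL_brk1 => //.
exact/inL_pred/inL_brk1.
Qed.

(** By [leibniz], a [w, v] = [w, a v] + c v with c = [a, w] in L_3. The case of M_(i+1) against L_2
    settles the first summand. For [b, c v], [brk_mul_swap] leaves [b c, v], [c, [b, v]] and
    [c, b v], handled by M_3, by [inL_brk] and by M_(i+1) against L_3. *)
Lemma inL_mul_brk2 i X Y Z T
    (b : hom X A) (a : hom Y A) (w : hom Z A) (v : hom T A) :
  (forall j, brk_ideal_sub i j) -> (forall j, brk_ideal_sub 2 j) ->
  inL 2 w -> inL i.+1 v -> inL i.+4 (brk b (mul a (brk w v))).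
Proof.
move=> Hi H2 wL vL; rewrite leibniz brkDr; apply: inLD; rewrite brk_compr; apply: inL_comp.
  by apply/inL_brk1/inL_brkC; rewrite -(addn1 i); apply: Hi.
have cL : inL 3 (brk a w) by apply: inL_brk1.
rewrite -[brk b _](addrK (brk (brk a w) (mul b v) \oc swap _ _ _)) brk_mul_swap.
apply: inLB; first apply: inLD; apply: inL_comp.
- exact: H2.
- by apply: inL_pred; apply: (inL_brk cL); apply: inL_brk1.
- by apply: inL_brkC; rewrite -addn2; apply: Hi.
Qed.

(** * Commutators with A L_j in characteristic zero *)

Hypothesis char_k0 : [pchar k] =i pred0.

Lemma hom_mulrn_eq0 X Y (f : hom X Y) n : f *+ n.+1 = 0 -> f = 0.
Proof.
move/eqP; rewrite -scaler_nat scaler_eq0 ((pcharf0P _).1 char_k0) /=.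
by move/eqP.
Qed.

Lemma brk_ideal_sub_step i :
  (forall j, brk_ideal_sub i j) -> (forall j, brk_ideal_sub 2 j) ->
  brk_ideal_sub i.+2 0.
Proof.
move=> Hi H2; apply: brk_ideal_sub_cover; set a := idm _; set l := sub_mor _.
have lL : inL i.+1 l := inL_lcs _.
set G := brk _ _; apply/inL_quot; set q := lcs_quot i.+2.
pose t := a \oxm swap A A (A \ox sub_dom (lcs A i.+1)).
pose s := a \oxm (a \oxm swap A A (sub_dom (lcs A i.+1))).
have Gt : q \oc G \oc t = - (q \oc G).
  apply/eqP; rewrite -addr_eq0 addrC -compA -compDr; apply/eqP/inL_quot.
  exact/inL_mul_brk_swap/inL_brk1.
have Gs : q \oc G \oc s = q \oc G.
  apply/eqP; rewrite -subr_eq0 -opprB oppr_eq0 -compA -compNr -compDr; apply/eqP/inL_quot.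
  (* By Jacobi the difference of the two orders of [p], [x] is [[p, x], v], the situation of
     [inL_mul_brk2] with w = [p, x]. *)
  rewrite -brk_compr -brkNr -brkDr -mul_compr -mulNr -mulDr {1}(jacobi a a l) addrK.
  by rewrite mul_compr brk_compr; apply/inL_comp/inL_mul_brk2 => //; apply/inL_brk1/inL1.
(* Applied to [q \oc G], the left word gives its negative and the right word gives it back, so its
   double vanishes. *)
have sts : s \oc t \oc s = t \oc s \oc t by rewrite -!tensm_comp swap_braid.
have /(congr1 (comp (q \oc G))) := sts.
rewrite !compA !(Gt, Gs, compNl) opprK => /eqP.
rewrite eq_sym -addr_eq0 -mulr2n => /eqP.
exact: hom_mulrn_eq0.
Qed.

(* The [t_i] act as the adjacent transpositions of five variables, and [F] spans a
   representation of S_5 on which the relations force [F = 2 (F t3) = 4 F]. *)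
Lemma curvature_eq0 X Y (F : hom X Y) (t1 t2 t3 t4 : hom X X) :
  t2 \oc t2 = idm X -> t3 \oc t3 = idm X ->
  t1 \oc t3 = t3 \oc t1 -> t2 \oc t4 = t4 \oc t2 ->
  t2 \oc t1 \oc t2 = t1 \oc t2 \oc t1 ->
  t3 \oc t2 \oc t3 = t2 \oc t3 \oc t2 ->
  t4 \oc t3 \oc t4 = t3 \oc t4 \oc t3 ->
  F \oc t1 = - F -> F \oc t2 = - F -> F \oc t4 = - F ->
  F = F \oc t3 - F \oc t3 \oc t4 -> F = 0.
Proof.
move=> t22 t33 t13 t24 b12 b23 b34 F1 F2 F4 FJ.
pose u := F \oc t3; pose v := u \oc t2.
have u4 : u \oc t4 = u - F by rewrite [F in RHS]FJ opprB addrC subrK.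
have u3 : u \oc t3 = F by rewrite -compA t33 comp_idr.
have u1 : u \oc t1 = - u by rewrite -compA -t13 compA F1 compNl.
have v2 : v \oc t2 = u by rewrite -compA t22 comp_idr.
have v3 : v \oc t3 = - v.
  by rewrite -!compA (compA t3) b23 !compA F2 !compNl.
have v4 : v \oc t4 = v + F by rewrite -compA t24 compA u4 compDl compNl F2 opprK.
have uE : F \oc t3 = u by [].
have u2 : u \oc t2 = v by [].
move: u v uE u2 u1 u3 u4 v2 v3 v4 => u v uE u2 u1 u3 u4 v2 v3 v4.
(* The braid relation of [t3], [t4] applied to [v] reads - v + u - 2 F = v - u; then divide by 2. *)
have vE : v = u - F.
  have /(congr1 (comp v)) := b34.
  rewrite !compA !(v4, v3, uE, u4, compDl, compNl) => E.
  apply/eqP; rewrite -subr_eq0; apply/eqP/(@hom_mulrn_eq0 _ _ _ 1).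
  transitivity (v - u - (- (v + F) + (u - F))); last by rewrite E opprD opprK subrr.
  by rewrite mulr2n !(opprD, opprK) !addrA (addrAC _ F v).
have v1 : v \oc t1 = - v by rewrite vE compDl compNl u1 F1 opprK opprB addrC.
(* On [u] the braid relation of [t1], [t2] reads - u = v. *)
have /(congr1 (comp u)) := b12.
rewrite !compA !(u1, u2, v1, v2, compNl) opprK => uv.
have FE : F = u + u by rewrite -[LHS](subKr u) -vE -uv opprK.
have uF : u = F + F by rewrite -uE {1}FE compDl u3.
apply: (@hom_mulrn_eq0 _ _ _ 2); apply: (addrI F).
by rewrite addr0 -mulrS [RHS]FE uF -!mulr2n -mulrnA.
Qed.

Lemma brk_ideal_sub2 : @brk_ideal_sub 2 0.
Proof.
apply: brk_ideal_sub_cover => /=; set a := idm _.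
set G := brk _ _; apply/inL_quot; set q := lcs_quot 2.
have uL : inL 2 (brk a a) by apply/inL_brk1/inL1.
(* Since L_1 is [A], all five variables b, a, p, x, y range over [A]; the last transposition has no
   factor to its right and is a [symm]. *)
apply: (@curvature_eq0 _ _ (q \oc G) (swap A A (A \ox (A \ox A)))
  (a \oxm swap A A (A \ox A)) (a \oxm (a \oxm swap A A A))
  (a \oxm (a \oxm (a \oxm symm A A)))).
- by rewrite -tensm_comp swapK comp_idl tensm_id.
- by rewrite -!tensm_comp swapK !comp_idl !tensm_id.
- by rewrite swap_nat.
- by rewrite -!tensm_comp swap_nat.
- by rewrite swap_braid.
- by rewrite -!tensm_comp swap_braid.
- by rewrite -!tensm_comp swap_symm_braid.
(* Antisymmetry in b, a modulo L_4, because [p, [x, y]] lies in L_3. *)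
- apply/eqP; rewrite -addr_eq0 addrC -compA -compDr; apply/eqP/inL_quot.
  rewrite brk_mul_swap.
  apply: inLD; apply: inL_comp; last apply: inL_pred.
    by apply: inL_brk1; apply: inL_brk1.
  by do 3!apply: inL_brk1.
- apply/eqP; rewrite -addr_eq0 addrC -compA -compDr; apply/eqP/inL_quot.
  exact: inL_mul_brk_swap.
- rewrite -compA -brk_compr -mul_compr -brk_compr brk_symm.
  by rewrite !(brkNr, mulNr) compNr.
(* Jacobi in the form [p, [x, y]] = [x, [p, y]] - [y, [p, x]]. *)
- rewrite -!(compA q) -compNr -compDr; congr (_ \oc _).
  rewrite -2!brk_compr -2!mul_compr -brkNr -brkDr -mulNr -mulDr /G.
  congr (brk a (mul a _)); rewrite {1}jacobi addrC; congr (_ + _).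
  by rewrite -compA -symm_tensV compA brk_symm compNl opprK.
Qed.

End LowerCentralSeries.

(** * The inclusion for all odd indices *)

Theorem theorem1p3 (k : fieldType) (char_k0 : [pchar k] =i pred0)
  (C : symTensorCat k) (A : algObj C) (j n : nat)
  (j_gt0 : (1 <= j)%N) (n_gt0 : (1 <= n)%N) (j_odd : odd j) :
  sub_le (sub_comm (lcs_ideal A j) (lcs A n)) (lcs A (n + j)%N).
Proof.
(* Indices of [brk_ideal_sub] are shifted by one, so [r.*2] stands for j = 2r + 1; the cases j = 1
   and j = 3 start the induction. *)
have sub r : forall m, brk_ideal_sub A r.*2 m.
  elim: r => [|[|r] IH]; first exact: brk_ideal_sub1.
    exact/brk_ideal_sub_ind/brk_ideal_sub2.
  apply/brk_ideal_sub_ind/brk_ideal_sub_step => //.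
  exact/brk_ideal_sub_ind/brk_ideal_sub2.
have jE : j = j./2.*2.+1 by rewrite -[LHS]odd_double_half j_odd.
case: n n_gt0 => // n _.
have [e ee eE] : exists2 e, epi e &
    sub_mor (lcs_ideal A j) \oc e = mul (idm (A : C)) (sub_mor (lcs A j)).
  by rewrite /mul -lock; exact: image_factor.
have [e' ee' eE'] : exists2 e', epi e' &
    sub_mor (sub_comm (lcs_ideal A j) (lcs A n.+1)) \oc e' =
    brk (sub_mor (lcs_ideal A j)) (sub_mor (lcs A n.+1)).
  by rewrite /brk -lock; exact: image_factor.
(* [sub_le] is [inL] of the inclusion morphism, so it descends along the covers of [M_j, L_n] and of
   M_j. *)
apply: (inL_epi ee'); rewrite eE'.
apply: (inL_epi (epi_tensml ee)); rewrite -brk_compl eE.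
have -> : (n.+1 + j)%N = (j./2.*2 + n).+2 by rewrite {1}jE addnS addSn addnC.
by apply: sub; rewrite -?jE; exact: inL_lcs.
Qed.
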